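(* Let $C\ge 2$ and let $\hat p_i(s)=\max\{s_i-\tau(s),0\}$, $s\in\mathbb R^C$, be the Sparsemax mapping, with Jacobian $J_{\mathrm{sp}}(s)=\nabla_s\hat p(s)$ where it exists. Within a fixed support region with support $\mathcal P$, $$J_{\mathrm{sp}}(s)\big|_{\mathcal P\times\mathcal P}=I_{|\mathcal P|}-\tfrac1{|\mathcal P|}\mathbf 1\mathbf 1^\top,\qquad J_{\mathrm{sp}}(s)\big|_{\mathcal P^c\times\{1,\dots,C\}}=0,$$ and the spectrum of the $\mathcal P\times\mathcal P$ block consists of $1$ with multiplicity $|\mathcal P|-1$ and $0$. Consequently $$\sup_{s}\|J_{\mathrm{sp}}(s)\|_2=1,$$ where the supremum is over all $s\in\mathbb R^C$ at which $\hat p$ is differentiable.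
   Context: $\tau(s)\in\mathbb R$ is the threshold with $\sum_{i=1}^C\max\{s_i-\tau(s),0\}=1$. The support at $s$ is $\{i:\hat p_i(s)>0\}$; ''within a fixed support region with support $\mathcal P$'' means at points $s$ such that the support equals $\mathcal P$ on a neighborhood of $s$. $\mathbf 1$ is the all-ones vector, $\mathcal P^c$ the complement of $\mathcal P$ in $\{1,\dots,C\}$, and $\|\cdot\|_2$ the spectral norm. *)

(* Defs.v *)
From mathcomp Require Import all_boot all_order all_algebra.
From mathcomp Require Import all_classical all_reals all_analysis.

Set Implicit Arguments.
Unset Strict Implicit.
Unset Printing Implicit Defensive.

Import Order.TTheory GRing.Theory Num.Theory.
Import numFieldNormedType.Exports.

Local Open Scope classical_set_scope.
Local Open Scope ring_scope.

(* Points of R^C are row vectors, as required by the library's [jacobian]. *)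

(* The equation has exactly one solution when 0 < C; the default value 0 of
   [xget] is only used for C = 0, where there is none. *)
Definition sparsemax_threshold (R : realType) (C : nat) (s : 'rV[R]_C) : R :=
  xget 0 [set t : R | \sum_(i < C) Num.max (s 0 i - t) 0 = 1].

Definition sparsemax (R : realType) (C : nat) (s : 'rV[R]_C) : 'rV[R]_C :=
  \row_(i < C) Num.max (s 0 i - sparsemax_threshold s) 0.

Definition sparsemax_support (R : realType) (C : nat) (s : 'rV[R]_C) :
  {set 'I_C} := [set i | 0 < sparsemax s 0 i]%SET.

(* [jacobian f s] acts on row vectors by right multiplication, so its (j, i)
   entry is the derivative of the i-th component along the j-th coordinate;
   transposing gives the usual matrix (row = component, column = variable).
   It is meaningful only where [sparsemax] is differentiable. *)
Definition sparsemax_jacobian (R : realType) (C : nat) (s : 'rV[R]_C) :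
  'M[R]_C := (jacobian (@sparsemax R C) s)^T.

(* The eigenvalues of A, listed with multiplicity, are exactly the terms of
   [l] (see [eigenvalue_root_char]). *)
Definition has_spectrum (R : realType) (n : nat) (A : 'M[R]_n) (l : seq R) :=
  char_poly A = \prod_(a <- l) ('X - a%:P).

(* The norm that the library puts on matrices is the maximum norm, hence
   the separate Euclidean norm. *)
Definition norm2 (R : realType) (n : nat) (x : 'cV[R]_n) : R :=
  Num.sqrt (\sum_(i < n) x i 0 ^+ 2).

Definition spectral_norm (R : realType) (m n : nat) (A : 'M[R]_(m, n)) : R :=
  sup [set norm2 (A *m x) | x in [set x : 'cV[R]_n | norm2 x <= 1]].

(* Main.v *)
Require Import Defs.
From mathcomp Require Import all_boot all_order all_algebra.
From mathcomp Require Import all_classical all_reals all_analysis.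
From mathcomp Require Import ring lra.

Set Implicit Arguments.
Unset Strict Implicit.
Unset Printing Implicit Defensive.

Import Order.TTheory GRing.Theory Num.Theory.
Import numFieldNormedType.Exports.

Local Open Scope classical_set_scope.
Local Open Scope ring_scope.

(* With support P, the sum constraint gives
   tau(s) = (sum of s over P - 1) / |P|, so on a fixed support region p is
   affine and its Jacobian is the centering matrix of P, extended by 0.
   At every point of differentiability the bound by 1 comes from p being the
   Euclidean projection onto the simplex: dividing
   |p(s + h v) - p(s)|^2 <= <h v, p(s + h v) - p(s)> by h^2 and letting
   h -> 0 gives |D|^2 <= <v, D> for D = D_v p(s), whence |D| <= |v|.
   The bound is attained at s = 0, whose neighbours all have full support. *)

(** * Existence of the threshold and firm nonexpansiveness *)

Lemma cvg_sumr (R : numFieldType) (V : normedModType R) (T I : Type)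
    (F : set_system T) (r : seq I) (f : I -> T -> V) (l : I -> V) :
  Filter F -> (forall i, f i x @[x --> F] --> l i) ->
  \sum_(i <- r) f i x @[x --> F] --> \sum_(i <- r) l i.
Proof. by move=> FF fl; apply: cvg_big => //; exact: add_continuous. Qed.

Lemma sparsemax_ge0 (R : realType) (C : nat) (s : 'rV[R]_C) i :
  0 <= sparsemax s 0 i.
Proof. by rewrite mxE le_max lexx orbT. Qed.

(** The sum [f t] is continuous in the threshold [t], is 0 at [M] and at least 1 at [- M - 1], where
    [M] bounds every [|s_i|]. By the intermediate value theorem the defining equation has a
    solution, so [xget] returns one and not its default. *)
Lemma sum_sparsemax (R : realType) (C : nat) (s : 'rV[R]_C) :
  (0 < C)%N -> \sum_(i < C) sparsemax s 0 i = 1.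
Proof.
move=> C0; pose f t := \sum_(i < C) Num.max (s 0 i - t) 0.
pose M := \sum_(i < C) `|s 0 i|.
have sM i : `|s 0 i| <= M.
  by rewrite /M (bigD1 i)//= lerDl sumr_ge0.
have M0 : 0 <= M by rewrite sumr_ge0.
have fM : f M = 0.
  rewrite /f big1// => i _; rewrite max_r// subr_le0.
  exact: le_trans (ler_norm _) (sM i).
have fN : 1 <= f (- M - 1).
  rewrite /f (bigD1 (Ordinal C0))//=.
  apply: (@le_trans _ _ (s 0 (Ordinal C0) - (- M - 1))); last first.
    rewrite -[leLHS]addr0 lerD// ?le_max ?lexx//.
    by apply: sumr_ge0 => i _; rewrite le_max lexx orbT.
  by have := sM (Ordinal C0); rewrite ler_norml => /andP[]; lra.
have cf : continuous f.
  move=> t; apply: cvg_sumr => i.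
  apply: (@continuous_max R R (fun t => s 0 i - t) (cst 0)).
    by apply: cvgB; [exact: cvg_cst|exact: cvg_id].
  exact: cvg_cst.
have [t _ ft] : exists2 t, t \in `[- M - 1, M] & f t = 1.
  apply: IVT; first by lra.
    exact: continuous_subspaceT.
  by rewrite fM ge_min ler01 orbT le_max fN.
under eq_bigr do rewrite mxE.
exact: (@xgetPex _ 0 [set t : R | f t = 1] (ex_intro _ t ft)).
Qed.

(* The residuals s - p(s) lie in the normal cone of the simplex at p(s),
   since s - p(s) equals tau(s) on the support and is at most tau(s) off it. *)
Lemma sparsemax_firmly_nonexpansive (R : realType) (C : nat)
    (s t : 'rV[R]_C) : (0 < C)%N ->
  \sum_i (sparsemax s 0 i - sparsemax t 0 i) ^+ 2 <=
  \sum_i (s 0 i - t 0 i) * (sparsemax s 0 i - sparsemax t 0 i).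
Proof.
move=> C0.
set a := sparsemax_threshold s; set b := sparsemax_threshold t.
(* The subtracted term [a - b] times the difference of the components sums to zero, since both
   points have component sum 1. With it, the inequality holds term by term: it is firm
   nonexpansiveness of the positive part, applied to [s_i - a] and [t_i - b]. *)
apply: (@le_trans _ _ (\sum_i ((s 0 i - t 0 i)
    * (sparsemax s 0 i - sparsemax t 0 i)
    - (a - b) * (sparsemax s 0 i - sparsemax t 0 i)))).
  apply: ler_sum => i _; rewrite !mxE -/a -/b.
  by case: (leP (s 0 i - a) 0) => ?; case: (leP (t 0 i - b) 0) => ?; nra.
by rewrite sumrB -mulr_sumr sumrB !sum_sparsemax// subrr mulr0 subr0.
Qed.

(** * Differentiation on a fixed support region *)

(** The remainder of the first-order expansion vanishes identically near [x], hence is [o(h)];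
    uniqueness of the differential identifies it with [A]. *)
Lemma is_diff_near_affine (R : numFieldType) (V W : normedModType R)
    (f : V -> W) (A : {linear V -> W}) (x : V) :
  continuous A -> (\forall y \near x, f y = f x + A (y - x)) ->
  is_diff x f A.
Proof.
move=> cA fA.
have fE : f \o shift x = cst (f x) + A +o_ 0 id.
  apply/eqaddoP => e e0.
  move: fA; rewrite (near_shift 0) subr0; apply: filterS => h /= fh.
  rewrite -[(_ - _) h]/(f (h + x) - (f x + A h)) [f _]fh addrK subrr normr0.
  by rewrite mulr_ge0// ltW.
have dfA := diff_unique cA fE.
by split => //; apply/diff_locallyP; rewrite dfA.
Qed.

Lemma mulmxr_continuous (R : realType) (m n : nat) (A : 'M[R]_(m, n)) :
  continuous (mulmxr A : 'rV[R]_m -> 'rV[R]_n).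
Proof.
move=> v; rewrite (_ : (mulmxr A : _ -> _) =
    fun u : 'rV[R]_m => \sum_i u 0 i *: row i A); last first.
  by apply/funext => u /=; rewrite mulmx_sum_row.
apply: (@cvg_sumr _ _ _ _ (nbhs v)) => i.
  by apply: cvgZr_tmp; exact: coord_continuous.
Qed.

(** Eliminates the threshold, so that for fixed [P] the right-hand side is affine in [s]; the
    indicator covers the components off the support. *)
Lemma sparsemax_supportE (R : realType) (C : nat) (s : 'rV[R]_C)
    (P : {set 'I_C}) i : (0 < C)%N -> sparsemax_support s = P ->
  sparsemax s 0 i =
  (i \in P)%:R * (s 0 i - #|P|%:R^-1 * (\sum_(j in P) s 0 j - 1)).
Proof.
move=> C0 sP.
have out j : j \notin P -> sparsemax s 0 j = 0.
  rewrite -sP inE -leNgt => pj; apply/eqP.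
  by rewrite eq_le pj sparsemax_ge0.
have inP j : j \in P -> sparsemax s 0 j = s 0 j - sparsemax_threshold s.
  by rewrite -sP inE mxE lt_max ltxx orbF => /ltW/max_l ->.
have := sum_sparsemax s C0.
rewrite (bigID (mem P))/= [X in _ + X]big1 ?addr0; last exact: out.
rewrite (eq_bigr _ inP) sumrB sumr_const => sum1.
have [iP|/out ->] := boolP (i \in P); last by rewrite mul0r.
have P0 : #|P|%:R != 0 :> R.
  by rewrite pnatr_eq0 -lt0n; apply/card_gt0P; exists i.
rewrite mul1r inP//; congr (_ - _); apply: (mulfI P0).
rewrite mulVKf// mulr_natl; apply/eqP.
by rewrite eq_sym subr_eq addrC -subr_eq sum1.
Qed.

(** With an empty support all components would vanish, although they sum to 1. *)
Lemma card_sparsemax_support_gt0 (R : realType) (C : nat) (s : 'rV[R]_C) :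
  (0 < C)%N -> (0 < #|sparsemax_support s|)%N.
Proof.
move=> C0; rewrite lt0n cards_eq0; apply/eqP => s0.
have := sum_sparsemax s C0; rewrite big1 => [|i _].
  by move/esym/eqP; rewrite oner_eq0.
by rewrite (sparsemax_supportE _ C0 s0) inE mul0r.
Qed.

(** The orthogonal projection onto the vectors supported in [P] with zero sum. *)
Definition centering_mx (R : realType) (C : nat) (P : {set 'I_C}) : 'M[R]_C :=
  \matrix_(i, j) ((i \in P)%:R * (j \in P)%:R * ((i == j)%:R - #|P|%:R^-1)).

Lemma tr_centering_mx (R : realType) (C : nat) (P : {set 'I_C}) :
  (centering_mx R P)^T = centering_mx R P.
Proof. by apply/matrixP => i j; rewrite !mxE eq_sym (mulrC (i \in P)%:R). Qed.

Lemma mul_centering_mx (R : realType) (C : nat) (P : {set 'I_C})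
    (v : 'rV[R]_C) i :
  (v *m centering_mx R P) 0 i =
  (i \in P)%:R * (v 0 i - #|P|%:R^-1 * \sum_(j in P) v 0 j).
Proof.
rewrite mxE; have [iP|iP] := boolP (i \in P); last first.
  by rewrite mul0r big1// => j _; rewrite mxE (negbTE iP) mulr0 mul0r mulr0.
rewrite mul1r (bigID (mem P))/= [X in _ + X]big1 ?addr0; last first.
  by move=> j jP; rewrite mxE (negbTE jP) !mul0r mulr0.
transitivity (\sum_(j in P) (v 0 j * (j == i)%:R - #|P|%:R^-1 * v 0 j)).
  by apply: eq_bigr => j jP; rewrite mxE jP iP !mul1r mulrBr [X in _ - X]mulrC.
rewrite sumrB -mulr_sumr (bigD1 i)//= eqxx mulr1 big1 ?addr0// => j.
by move=> /andP[_ /negbTE ->]; rewrite mulr0.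
Qed.

Lemma is_diff_sparsemax (R : realType) (C : nat) (P : {set 'I_C})
    (s : 'rV[R]_C) : (0 < C)%N ->
  (\forall t \near s, sparsemax_support t = P) ->
  is_diff s (@sparsemax R C) (mulmxr (centering_mx R P)).
Proof.
move=> C0 nearP; apply: is_diff_near_affine; first exact: mulmxr_continuous.
have sP := nbhs_singleton nearP.
apply: filterS nearP => t tP; apply/rowP => i.
rewrite [RHS]mxE/= mul_centering_mx !(sparsemax_supportE _ C0 tP).
rewrite (sparsemax_supportE _ C0 sP).
under [X in _ = _ + _ * (_ - _ * X)]eq_bigr do rewrite !mxE.
by rewrite sumrB !mxE; ring.
Qed.

Lemma sparsemax_jacobianE (R : realType) (C : nat) (P : {set 'I_C})
    (s : 'rV[R]_C) : (0 < C)%N ->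
  (\forall t \near s, sparsemax_support t = P) ->
  sparsemax_jacobian s = centering_mx R P.
Proof.
move=> C0 nearP; have dA := is_diff_sparsemax C0 nearP.
(* Row [i] of [jacobian] is the differential at the [i]-th basis vector; symmetry of the centering
   matrix absorbs the transpose. *)
rewrite -tr_centering_mx; congr trmx; apply/row_matrixP => i.
by rewrite rowE mul_rV_lin1 diff_val/= -rowE.
Qed.

(** * Spectrum of the centering block *)

(* Both sides equal a times the determinant of the block matrix
   [a%:M, u; -v, 1], cleared by column, respectively row, operations. *)
Lemma det_scalar_addmx_rank1 (R : comNzRingType) (n : nat) (a : R)
    (u : 'cV[R]_n) (v : 'rV[R]_n) :
  a * \det (a%:M + u *m v) = a ^+ n * (a + (v *m u) 0 0).
Proof.
pose M := block_mx a%:M u (- v) (1%:M : 'M[R]_1).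
have detM : \det M = \det (a%:M + u *m v).
  have : M *m block_mx 1%:M 0 v 1%:M = block_mx (a%:M + u *m v) u 0 1%:M.
    by rewrite mulmx_block !mulmx1 !mulmx0 mul1mx !add0r addNr.
  move/(congr1 determinant).
  by rewrite det_mulmx det_lblock det_ublock !det1 !mulr1.
have : block_mx 1%:M 0 v a%:M *m M = block_mx a%:M u 0 (v *m u + a%:M).
  rewrite mulmx_block !mul1mx !mul0mx !addr0 mul_mx_scalar mul_scalar_mx mulmx1.
  by rewrite scalerN addrN.
move/(congr1 determinant).
rewrite det_mulmx det_lblock det_ublock det1 mul1r !det_scalar expr1 detM => ->.
by rewrite det_mx11 !mxE eqxx addrC.
Qed.

(** The characteristic matrix is the scalar ['X - 1] plus a rank-one matrix [u *m v] with
    [v *m u = 1]. The rank-one determinant formula gives the characteristic polynomial times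
    ['X - 1], a nonzero factor that is cancelled. *)
Lemma has_spectrum_centering (R : realType) (n : nat) : (0 < n)%N ->
  has_spectrum (1%:M - n%:R^-1 *:
    ((const_mx 1 : 'cV[R]_n) *m (const_mx 1 : 'cV[R]_n)^T))
    (0 :: nseq n.-1 1).
Proof.
case: n => // n _; rewrite /has_spectrum big_cons big_nseq iter_mulr_1 subr0.
have X1 : ('X - 1%:P : {poly R}) != 0 by rewrite polyXsubC_eq0.
apply: (mulfI X1).
rewrite /char_poly /char_poly_mx.
set u := const_mx 1 : 'cV[{poly R}]_n.+1.
set v := const_mx (n.+1%:R^-1)%:P : 'rV[{poly R}]_n.+1.
rewrite [X in \det X](_ : _ = ('X - 1%:P)%:M + u *m v); last first.
  apply/matrixP => i j; rewrite !mxE !big_ord1 !mxE mulr1 mul1r.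
  by rewrite mulr1 mulrnBl !rmorphB/= rmorphMn/=; ring.
rewrite det_scalar_addmx_rank1 mulrCA -exprS mulrC; congr (_ * _).
rewrite mxE (eq_bigr (fun=> (n.+1%:R^-1)%:P)); last first.
  by move=> i _; rewrite !mxE mulr1.
rewrite sumr_const card_ord -rmorphMn/= -[_ *+ _]mulr_natl divff ?pnatr_eq0//.
by rewrite subrK.
Qed.

(** * Contraction at points of differentiability *)

Lemma sparsemax_derive_firmly_nonexpansive (R : realType) (C : nat)
    (s v : 'rV[R]_C) : (0 < C)%N -> derivable (@sparsemax R C) s v ->
  \sum_i ('D_v (@sparsemax R C) s) 0 i ^+ 2 <=
  \sum_i v 0 i * ('D_v (@sparsemax R C) s) 0 i.
Proof.
move=> C0 dv; set D := 'D_v _ s.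
pose q h := h^-1 *: (sparsemax (h *: v + s) - sparsemax s).
have qD i : q h 0 i @[h --> 0^'] --> D 0 i.
  by apply: (@cvg_comp _ _ _ q (fun M : 'rV[R]_C => M 0 i) _ (nbhs D));
    [exact: dv | exact: coord_continuous].
pose g h := \sum_i (v 0 i * q h 0 i - q h 0 i ^+ 2).
have gD : g h @[h --> 0^'] --> \sum_i (v 0 i * D 0 i - D 0 i ^+ 2).
  apply: cvg_sumr => i; apply: cvgB.
    by apply: cvgM; [exact: cvg_cst|exact: qD].
  by under eq_fun do rewrite expr2; exact: cvgM.
rewrite -subr_ge0 -sumrB -(cvg_lim _ gD)//.
apply: limr_ge; first by apply/cvg_ex; eexists; exact: gD.
near=> h.
have h0 : h != 0 by near: h; exact: nbhs_dnbhs_neq.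
(* Multiplying by [h ^+ 2], positive for either sign of [h], turns [g h] into the gap in the firm
   nonexpansiveness inequality between [h *: v + s] and [s]. *)
rewrite -(pmulr_rge0 _ (_ : 0 < h ^+ 2)) ?exprn_even_gt0//.
have qE i : q h 0 i = h^-1 * (sparsemax (h *: v + s) 0 i - sparsemax s 0 i).
  rewrite [LHS]mxE; congr (_ * _); rewrite [LHS]mxE; congr (_ + _).
  by rewrite [LHS]mxE.
have -> : h ^+ 2 * g h =
    \sum_i ((h *: v + s) 0 i - s 0 i)
      * (sparsemax (h *: v + s) 0 i - sparsemax s 0 i)
    - \sum_i (sparsemax (h *: v + s) 0 i - sparsemax s 0 i) ^+ 2.
  rewrite -sumrB mulr_sumr; apply: eq_bigr => i _.
  have -> : (h *: v + s) 0 i - s 0 i = h * v 0 i by rewrite 2!mxE addrK.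
  by rewrite qE; field.
by rewrite subr_ge0; exact: sparsemax_firmly_nonexpansive.
Unshelve. all: by end_near. Qed.

Lemma norm2_sparsemax_jacobian (R : realType) (C : nat) (s : 'rV[R]_C)
    (x : 'cV[R]_C) : (0 < C)%N -> differentiable (@sparsemax R C) s ->
  norm2 (sparsemax_jacobian s *m x) <= norm2 x.
Proof.
move=> C0 ds.
have dv : derivable (@sparsemax R C) s x^T by exact: diff_derivable.
have := sparsemax_derive_firmly_nonexpansive C0 dv.
rewrite /= (deriveEjacobian _ ds) => le_DD; apply: ler_wsqrtr.
have -> : sparsemax_jacobian s *m x = (x^T *m jacobian (@sparsemax R C) s)^T.
  by rewrite trmx_mul trmxK.
set D := x^T *m _ in le_DD *.
under eq_bigr do rewrite mxE.
have xE i : x i 0 = x^T 0 i by rewrite mxE.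
under [X in _ <= X]eq_bigr do rewrite xE.
rewrite -subr_ge0 -sumrB.
(* Here [|x|^2 - |D|^2 = |x - D|^2 + 2 (<x, D> - |D|^2)], and both terms are nonnegative. *)
have -> : \sum_i (x^T 0 i ^+ 2 - D 0 i ^+ 2) =
    \sum_i (x^T 0 i - D 0 i) ^+ 2
    + 2 * (\sum_i x^T 0 i * D 0 i - \sum_i D 0 i ^+ 2).
  by rewrite -sumrB mulr_sumr -big_split/=; apply: eq_bigr => i _; ring.
by rewrite addr_ge0 ?mulr_ge0 ?subr_ge0// sumr_ge0// => i _; exact: sqr_ge0.
Qed.

(** * The spectral norm and its value at the origin *)

Lemma norm2_0 (R : realType) (n : nat) : norm2 (0 : 'cV[R]_n) = 0.
Proof. by rewrite /norm2 big1 ?sqrtr0// => i _; rewrite mxE expr0n. Qed.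

Lemma spectral_norm_le1 (R : realType) (m n : nat) (A : 'M[R]_(m, n)) :
  (forall x, norm2 (A *m x) <= norm2 x) -> spectral_norm A <= 1.
Proof.
move=> A1; apply: ge_sup => [|_ [x x1 <-]]; last exact: le_trans (A1 x) x1.
by exists (norm2 (A *m 0)), 0 => //=; rewrite norm2_0 ler01.
Qed.

Lemma spectral_norm_eq1 (R : realType) (m n : nat) (A : 'M[R]_(m, n)) x :
  (forall x, norm2 (A *m x) <= norm2 x) -> norm2 x = 1 ->
  norm2 (A *m x) = 1 -> spectral_norm A = 1.
Proof.
move=> A1 x1 Ax1; apply/eqP; rewrite eq_le spectral_norm_le1//= -{1}Ax1.
apply: ub_le_sup; last by exists x => //=; rewrite x1.
by exists 1 => _ [y y1 <-]; exact: le_trans (A1 y) y1.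
Qed.

(** Let all [|s_j|] be below [e = 1 / (2C)]. If component [i] vanished, the threshold would be at
    least [s_i > - e], so every component would be below [2 * e] and their sum below 1. *)
Lemma sparsemax_support_near0 (R : realType) (C : nat) : (0 < C)%N ->
  \forall s \near (0 : 'rV[R]_C), sparsemax_support s = [set: 'I_C]%SET.
Proof.
move=> C0; pose e : R := (2 * C%:R)^-1.
have CR0 : 0 < C%:R :> R by rewrite ltr0n.
have e0 : 0 < e by rewrite invr_gt0 mulr_gt0.
have near_e (i : 'I_C) : \forall s \near nbhs (0 : 'rV[R]_C), 
    `|(s : 'rV[R]_C) 0 i| < e.
  apply: cvgr0_norm_lt e0.
  by have := @coord_continuous R 1 C 0 i 0; rewrite /continuous_at mxE.
have := filter_forall (nbhs_filter _) near_e.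
apply: filterS => s se; apply/setP => i; rewrite !inE.
apply: contraT; rewrite mxE lt_max ltxx orbF -leNgt subr_le0 => si.
have := sum_sparsemax s C0; suff : \sum_(j < C) sparsemax s 0 j < 1.
  by move=> /[swap] ->; rewrite ltxx.
have -> : 1 = \sum_(j < C) (2 * e).
  by rewrite sumr_const card_ord -mulr_natl /e; field; rewrite gt_eqF.
apply: ltr_sum; first by apply/hasP; exists i => //; rewrite mem_index_enum.
move=> j _; rewrite mxE gt_max mulr_gt0// andbT.
by move: (se i) (se j); rewrite !ltr_norml => /andP[? ?] /andP[? ?]; lra.
Qed.

Lemma spectral_norm_sparsemax_jacobian0 (R : realType) (C : nat) :
  (2 <= C)%N -> spectral_norm (sparsemax_jacobian (0 : 'rV[R]_C)) = 1.
Proof.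
case: C => [|[|C]] // _.
have C0 : (0 < C.+2)%N by [].
have near0 := sparsemax_support_near0 R C0.
have ds : differentiable (@sparsemax R C.+2) 0.
  by have := is_diff_sparsemax C0 near0; case.
(* A unit vector with zero sum, hence fixed by the centering matrix of the full support; its two
   nonzero entries are where [2 <= C] enters. *)
pose x : 'cV[R]_C.+2 :=
  \col_i ((Num.sqrt 2)^-1 * ((i == 0)%:R - (i == 1)%:R)).
have Jx : sparsemax_jacobian 0 *m x = x.
  rewrite (sparsemax_jacobianE C0 near0) -tr_centering_mx -[X in _ *m X]trmxK.
  rewrite -trmx_mul -[RHS]trmxK; congr trmx; apply/rowP => i.
  rewrite mul_centering_mx inE mul1r (_ : \sum_(j in _) _ = 0) ?mulr0 ?subr0//.
  under eq_bigr do rewrite !mxE.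
  rewrite (eq_bigl xpredT) => [|j]; last by rewrite inE.
  rewrite -mulr_sumr sumrB.
  rewrite (bigD1 0)// [X in _ - X](bigD1 1)//= !big1.
  - by rewrite subrr mulr0.
  - by move=> j /negbTE ->.
  - by move=> j /negbTE ->.
have nx : norm2 x = 1.
  rewrite /norm2 big_ord_recl big_ord_recl big1 => [|i _].
    rewrite !mxE/= addr0 subr0 sub0r !mulr1 mulrN1 sqrrN exprVn sqr_sqrtr//.
    by rewrite -div1r -splitr sqrtr1.
  by rewrite !mxE/= subrr mulr0 expr0n.
apply: (@spectral_norm_eq1 _ _ _ _ x); rewrite ?Jx//.
by move=> y; exact: norm2_sparsemax_jacobian.
Qed.

Theorem lemmaB6 (R : realType) (C : nat) (hC : (2 <= C)%N) :
  (forall (P : {set 'I_C}) (s : 'rV[R]_C),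
     (\forall s' \near s, sparsemax_support s' = P) ->
     let J := sparsemax_jacobian s in
     let JPP : 'M[R]_#|P| := mxsub enum_val enum_val J in
     [/\ differentiable (@sparsemax R C) s,
         JPP = 1%:M - #|P|%:R^-1 *:
                 ((const_mx 1 : 'cV[R]_#|P|) *m (const_mx 1 : 'cV[R]_#|P|)^T),
         (forall i j : 'I_C, i \in ~: P -> J i j = 0) &
         has_spectrum JPP (0 :: nseq #|P|.-1 1)])
  /\
  sup [set spectral_norm (sparsemax_jacobian s) |
        s in [set s : 'rV[R]_C | differentiable (@sparsemax R C) s]] = 1.
Proof.
have C0 : (0 < C)%N by exact: ltnW.
split=> [P s nearP J JPP|].
  have JPPE : JPP = 1%:M - #|P|%:R^-1 *:
      ((const_mx 1 : 'cV[R]_#|P|) *m (const_mx 1 : 'cV[R]_#|P|)^T).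
    apply/matrixP => i j; rewrite /JPP /J (sparsemax_jacobianE C0 nearP).
    rewrite !mxE big_ord1 !mxE !enum_valP (inj_eq enum_val_inj).
    by rewrite !mul1r mulr1.
  split=> //.
  - by have := is_diff_sparsemax C0 nearP; case.
  - move=> i j; rewrite inE /J (sparsemax_jacobianE C0 nearP) mxE => /negbTE ->.
    by rewrite !mul0r.
  - rewrite JPPE; apply: has_spectrum_centering.
    by rewrite -(nbhs_singleton nearP); exact: card_sparsemax_support_gt0.
have ub1 : ubound [set spectral_norm (sparsemax_jacobian s) |
    s in [set s : 'rV[R]_C | differentiable (@sparsemax R C) s]] 1.
  move=> _ [s ds <-]; apply: spectral_norm_le1 => x.
  exact: norm2_sparsemax_jacobian.
(* The upper bound 1 is itself a member of the set, attained at the origin, so it is the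
   supremum. *)
have S1 : [set spectral_norm (sparsemax_jacobian s) |
    s in [set s : 'rV[R]_C | differentiable (@sparsemax R C) s]] 1.
  exists 0; last exact: spectral_norm_sparsemax_jacobian0.
  by have := is_diff_sparsemax C0 (sparsemax_support_near0 R C0); case.
apply/eqP; rewrite eq_le ge_sup//=; last by exists 1.
by apply: ub_le_sup S1; exists 1.
Qed.
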